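(* Let $\mathcal{S}_Z=(s_Z(n)\bmod 2)_{n\ge 0}$, where $s_Z(n)$ is the sum of digits of $n$ in the Zeckendorf numeration system, and let $\varphi=(1+\sqrt5)/2$. There exists $N_0>0$ such that for all integers $N>N_0$, \[ M(\mathcal{S}_Z,N)\ \ge\ \frac{1}{\varphi+\varphi^3}\,N+1, \] where $M(\mathcal{S},N)$ denotes the $N$th maximum order complexity.
   Context: Fibonacci numbers: $F_0=0$, $F_1=1$, $F_{n+2}=F_{n+1}+F_n$. Every integer $n\ge 0$ has a unique Zeckendorf representation $n=\sum_{i\ge0}\varepsilon_i(n)F_{i+2}$ with $\varepsilon_i(n)\in\{0,1\}$ and $\varepsilon_i(n)\varepsilon_{i+1}(n)=0$ for all $i$; set $s_Z(n)=\sum_{i\ge0}\varepsilon_i(n)$. Maximum order complexity: for a binary sequence $\mathcal{S}=(s_n)_{n\ge0}$ over $\{0,1\}=\mathbb{F}_2$ and an integer $N\ge2$ with $(s_0,\dots,s_{N-2})$ not constant, $M(\mathcal{S},N)$ is the smallest positive integer $M$ such that there is a polynomial $f\in\mathbb{F}_2[x_1,\dots,x_M]$ with $s_{i+M}=f(s_i,\dots,s_{i+M-1})$ for all $0\le i\le N-M-1$. If $s_0=\dots=s_{N-2}=a$, then $M(\mathcal{S},N)=0$ if $s_{N-1}=a$ and $M(\mathcal{S},N)=N-1$ otherwise. *)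

(* Defs.v *)
From mathcomp Require Import all_boot all_order all_algebra.
From mathcomp Require Import mpoly.
From mathcomp Require Import boolp reals.

Set Implicit Arguments.
Unset Strict Implicit.
Unset Printing Implicit Defensive.

Import GRing.Theory.

Local Open Scope nat_scope.

Fixpoint fib (n : nat) : nat :=
  if n is n1.+1 then (if n1 is n2.+1 then fib n1 + fib n2 else 1) else 0.
Arguments fib : simpl never.

(* The sum over all i >= 0 of the terms e i * F_(i+2) is read off at any K
   beyond which all digits vanish. *)
Definition zeckendorf_rep (n : nat) (e : nat -> bool) : Prop :=
  (exists2 K, forall i, K <= i -> e i = false & n = \sum_(i < K) e i * fib i.+2)
  /\ forall i, ~~ (e i && e i.+1).

(* Greedy expansion using only F_2, ..., F_(K+1). *)
Fixpoint greedy_digit (K n i : nat) : bool :=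
  if K is k.+1 then
    if fib k.+2 <= n then (i == k) || greedy_digit k (n - fib k.+2) i
    else greedy_digit k n i
  else false.

(* Justified by zeckendorf_digitP and zeckendorf_rep_uniq below; K = n is
   enough because n < F_(n+2). *)
Definition zeckendorf_digit (n i : nat) : bool := greedy_digit n n i.

Lemma fibSS n : fib n.+2 = fib n.+1 + fib n.
Proof. by []. Qed.

Lemma fib_gt0 n : 0 < fib n.+1.
Proof. by elim: n => [//|n IHn]; rewrite fibSS addn_gt0 IHn. Qed.

Lemma ltn_fib n : n < fib n.+2.
Proof.
elim: n => [//|n IHn]; rewrite fibSS.
by have := leq_add IHn (fib_gt0 n); rewrite addn1.
Qed.

Lemma leq_fib m n : m <= n -> fib m <= fib n.
Proof.
move=> /subnKC <-; elim: (n - m) => [|d IHd]; first by rewrite addn0.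
apply: (leq_trans IHd); rewrite addnS.
by case: (m + d) => [//|k]; rewrite fibSS leq_addr.
Qed.

Lemma greedy_digit_geq K n i : K <= i -> greedy_digit K n i = false.
Proof.
elim: K n => [//|K IHK] n leKi /=.
by case: ifP => _; rewrite !IHK ?(ltnW leKi) // (gtn_eqF leKi).
Qed.

Lemma greedy_digit_small K n i : n < fib i.+2 -> greedy_digit K n i = false.
Proof.
elim: K n => [//|K IHK] n ltn /=; case: ifP => [leKn|_]; last exact: IHK.
rewrite IHK ?(leq_ltn_trans (leq_subr _ _) ltn) // orbF.
by apply/eqP => eq_iK; move: ltn; rewrite eq_iK ltnNge leKn.
Qed.

Lemma greedy_digit_sum K n :
  n < fib K.+2 -> \sum_(i < K) greedy_digit K n i * fib i.+2 = n.
Proof.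
elim: K n => [|K IHK] n; first by rewrite big_ord0; case: n.
move=> ltn; rewrite big_ord_recr /=; case: leqP => [leKn|ltnK].
  have ltd : n - fib K.+2 < fib K.+1 by rewrite ltn_subLR.
  rewrite eqxx /= mul1n.
  under eq_bigr => i _ do rewrite (ltn_eqF (ltn_ord i)) /=.
  by rewrite IHK ?subnK // (leq_trans ltd) // leq_fib.
by rewrite IHK // greedy_digit_geq // mul0n addn0.
Qed.

Lemma greedy_digit_sparse K n i :
  n < fib K.+2 -> ~~ (greedy_digit K n i && greedy_digit K n i.+1).
Proof.
elim: K n => [//|K IHK] n ltn /=; case: leqP => [leKn|ltnK]; last exact: IHK.
have ltd : n - fib K.+2 < fib K.+1 by rewrite ltn_subLR.
have ltd' : n - fib K.+2 < fib K.+2 by rewrite (leq_trans ltd) // leq_fib.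
have [->|neiK] /= := eqVneq i K.
  by rewrite (gtn_eqF (ltnSn K)) greedy_digit_geq.
have [eqK|_] /= := eqVneq i.+1 K; last exact: IHK.
by rewrite greedy_digit_small ?eqK.
Qed.

Lemma zeckendorf_digitP n : zeckendorf_rep n (zeckendorf_digit n).
Proof.
split; last by move=> i; exact/greedy_digit_sparse/ltn_fib.
exists n; first by move=> i; exact: greedy_digit_geq.
by rewrite greedy_digit_sum ?ltn_fib.
Qed.

Lemma sparse_sum_lt (e : nat -> bool) K : (forall i, ~~ (e i && e i.+1)) ->
  \sum_(i < K) e i * fib i.+2 < fib K.+2.
Proof.
move=> spe; suff [] : \sum_(i < K) e i * fib i.+2 < fib K.+2 /\
  \sum_(i < K.+1) e i * fib i.+2 < fib K.+3 by [].
elim: K => [|K [IH1 IH2]].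
  by rewrite big_ord_recr !big_ord0 /=; case: (e 0).
split=> //; rewrite big_ord_recr /=.
case eK1: (e K.+1); last first.
  by rewrite mul0n addn0 (leq_trans IH2) // leq_fib.
have eK : e K = false by have := spe K; rewrite eK1 andbT; case: (e K).
rewrite big_ord_recr /= eK mul0n addn0 mul1n.
by rewrite [fib K.+4]fibSS addnC -addnS leq_add2l.
Qed.

Lemma zeckendorf_rep_uniq n e1 e2 :
  zeckendorf_rep n e1 -> zeckendorf_rep n e2 -> e1 =1 e2.
Proof.
move=> [[K1 z1 s1] sp1] [[K2 z2 s2] sp2].
have widen (e : nat -> bool) K L : K <= L -> (forall i, K <= i -> e i = false) ->
    \sum_(i < K) e i * fib i.+2 = \sum_(i < L) e i * fib i.+2.
  move=> /subnKC <- z; elim: (L - K) => [|d IHd]; first by rewrite addn0.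
  by rewrite addnS big_ord_recr /= z ?leq_addr // mul0n addn0.
set L := maxn K1 K2.
rewrite (widen _ _ L) ?leq_maxl // in s1; rewrite (widen _ _ L) ?leq_maxr // in s2.
have eqL i : L <= i -> e1 i = e2 i.
  by rewrite geq_max => /andP[/z1-> /z2->].
move: s1; rewrite {n}s2; move: eqL; elim: {z1 z2}L => [eqL _ i|L IHL eqL].
  exact: eqL.
rewrite !big_ord_recr /= => eqs.
have eqe : e1 L = e2 L.
  have := sparse_sum_lt L sp1; have := sparse_sum_lt L sp2.
  move: eqs; case: (e1 L); case: (e2 L) => //;
    rewrite mul1n mul0n addn0.
  - by move=> -> ; rewrite ltnNge leq_addl.
  - by move=> <- _; rewrite ltnNge leq_addl.
apply: IHL; last by move: eqs; rewrite eqe => /addIn.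
by move=> i; rewrite leq_eqVlt => /predU1P[<- //|]; exact: eqL.
Qed.

Definition zeckendorf_sum (n : nat) : nat := \sum_(i < n) zeckendorf_digit n i.

(* Digits at indices i >= n vanish, so nothing is lost in zeckendorf_sum. *)
Lemma zeckendorf_digit_geq n i : n <= i -> zeckendorf_digit n i = false.
Proof. exact: greedy_digit_geq. Qed.

Definition zeckendorf_seq (n : nat) : 'F_2 := ((zeckendorf_sum n)%:R)%R.

(* The range 0 <= i <= N - M - 1 of integers (possibly empty) is i + M < N. *)
Definition feedback (S : nat -> 'F_2) (N M : nat) : Prop :=
  exists f : {mpoly 'F_2[M]}, forall i, i + M < N ->
    S (i + M) = meval (fun j : 'I_M => S (i + j)) f.

Lemma feedback_ex (S : nat -> 'F_2) (N : nat) :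
  exists M, (0 < M) && `[< feedback S N M >].
Proof.
exists N.+1; apply/asboolP; exists 0%R => i.
by rewrite addnS ltnNge -ltnS ltnS leqW // leq_addl.
Qed.

(* Meaningful for N >= 2 only. *)
Definition max_order_complexity (S : nat -> 'F_2) (N : nat) : nat :=
  if [forall k : 'I_N.-1, S k == S 0] then
    (if S N.-1 == S 0 then 0 else N.-1)
  else ex_minn (feedback_ex S N).

(* Main.v *)
Require Import Defs.
From mathcomp Require Import all_boot all_order all_algebra.
From mathcomp Require Import reals.
From mathcomp Require Import mpoly boolp zify ring lra.

Import Order.TTheory GRing.Theory Num.Theory.
Local Open Scope ring_scope.

(** If two windows of length [L] agree but are followed by different symbols,
    no feedback function of order at most [L] exists. Since adding [F_m] to some
    [n < F_(m-1)] increases the digit sum by one, the windows of length [F_k]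
    starting at [F_(k+1)] and [F_(k+2)] agree, whereas the next symbols, at
    [F_(k+1) + F_k = F_(k+2)] and [F_(k+2) + F_k], differ. This handles
    [F_k + F_(k+2) < N <= F_(k+1) + F_(k+3)], because
    [F_(k+1) - phi F_k = (1 - phi)^k]. For odd [k] this error term has the right
    sign; for even [k] it is compensated by extending both windows one step to
    the left, as [F_(k+1) - 1] and [F_(k+2) - 1] then have the same digit sum. *)

Lemma feedback_order_gt (S : nat -> 'F_2) (N M L i j : nat) :
  (forall n, (n < L)%N -> S (i + n)%N = S (j + n)%N) ->
  S (i + L)%N != S (j + L)%N -> (i + L < N)%N -> (j + L < N)%N ->
  feedback S N M -> (L < M)%N.
Proof.
move=> eqS neqS iLN jLN [f Sf]; rewrite ltnNge; apply: contra neqS => leML.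
(* If [M <= L], then [f] reads only the last [M] symbols of each window, so it would predict equal
   successors. *)
have shift h : (h + L = h + (L - M) + M)%N by rewrite -addnA subnK.
rewrite !shift !Sf -?shift //; apply/eqP; congr (meval _ f); apply/funext => l.
by rewrite -!addnA eqS // -ltn_subRL subKn.
Qed.

Lemma sum_ord_widen0 (F : nat -> nat) m n : (m <= n)%N ->
  (forall i, (m <= i)%N -> F i = 0%N) ->
  (\sum_(i < m) F i = \sum_(i < n) F i)%N.
Proof.
move=> /subnKC <- F0; elim: (n - m)%N => [|d IHd]; first by rewrite addn0.
by rewrite addnS big_ord_recr /= F0 ?leq_addr // addn0.
Qed.

Lemma sum_ord_eq0 (F : nat -> nat) m n :
  (forall i, (m <= i)%N -> F i = 0%N) -> (forall i, (n <= i)%N -> F i = 0%N) ->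
  (\sum_(i < m) F i = \sum_(i < n) F i)%N.
Proof.
move=> Fm Fn; rewrite (sum_ord_widen0 _ _ _ (leq_maxl m n) Fm).
by rewrite -(sum_ord_widen0 _ _ _ (leq_maxr m n) Fn).
Qed.

Lemma zeckendorf_sum_digits n K :
  (forall i, (K <= i)%N -> zeckendorf_digit n i = false) ->
  zeckendorf_sum n = (\sum_(i < K) zeckendorf_digit n i)%N.
Proof.
move=> d0; apply: (sum_ord_eq0 (zeckendorf_digit n)) => i lei.
  by rewrite zeckendorf_digit_geq.
by rewrite d0.
Qed.

Lemma zeckendorf_sum_fibD m n : (n < fib m.+1)%N ->
  zeckendorf_sum (fib m.+2 + n) = (zeckendorf_sum n).+1.
Proof.
move=> ltnm; pose d := zeckendorf_digit n.
(* Digit [m.-1] must vanish too: the new digit at [m] may have no neighbour. *)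
have d0 i : (m.-1 <= i)%N -> d i = false.
  move=> lei; apply: greedy_digit_small; apply: leq_trans ltnm _.
  by apply: leq_fib; lia.
have d0m i : (m <= i)%N -> d i = false by move=> lei; apply: d0; lia.
have sum_d : (\sum_(i < m) d i * fib i.+2 = n)%N.
  rewrite -[RHS](greedy_digit_sum (ltn_fib n)).
  apply: (sum_ord_eq0 (fun i => d i * fib i.+2)%N) => i lei; first by rewrite d0m.
  by rewrite /d zeckendorf_digit_geq.
pose e i := (i == m) || d i.
have e_lt (i : 'I_m) : e i = d i by rewrite /e (ltn_eqF (ltn_ord i)).
have e_m : e m by rewrite /e eqxx.
have e0 i : (m < i)%N -> e i = false.
  by move=> ltmi; rewrite /e (gtn_eqF ltmi) d0m // ltnW.
have rep_e : zeckendorf_rep (fib m.+2 + n) e.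
  split.
    exists m.+1 => //; rewrite big_ord_recr /= e_m mul1n [RHS]addnC.
    congr (_ + _)%N.
    by rewrite -[LHS]sum_d; apply: eq_bigr => i _; rewrite e_lt.
  move=> i; rewrite /e.
  have [->|_] := eqVneq i m.
    by rewrite (gtn_eqF (ltnSn m)) [d m.+1]d0m ?andbF.
  have [im|_] /= := eqVneq i.+1 m; last first.
    exact: greedy_digit_sparse (ltn_fib n).
  by rewrite d0 //; lia.
have digits_e := zeckendorf_rep_uniq (zeckendorf_digitP (fib m.+2 + n)) rep_e.
rewrite (zeckendorf_sum_digits _ m.+1); last by move=> i /e0; rewrite digits_e.
rewrite (zeckendorf_sum_digits n m) // big_ord_recr /= digits_e e_m addn1.
by congr S; apply: eq_bigr => i _; rewrite digits_e e_lt.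
Qed.

Lemma zeckendorf_sum_fib m : zeckendorf_sum (fib m.+2) = 1%N.
Proof.
rewrite -[fib _]addn0 zeckendorf_sum_fibD ?fib_gt0 //.
by rewrite /zeckendorf_sum big_ord0.
Qed.

(** $F_{m+4}-1 = F_{m+3} + (F_{m+2}-1)$ splits off the leading digit. *)
Lemma zeckendorf_sum_fib_pred m :
  zeckendorf_sum (fib m.+4).-1 = (zeckendorf_sum (fib m.+2).-1).+1.
Proof.
rewrite -(zeckendorf_sum_fibD m.+1) ?prednK ?fib_gt0 //; congr zeckendorf_sum.
by rewrite [fib m.+4]fibSS; move: (fib_gt0 m.+1); lia.
Qed.

Lemma zeckendorf_sum_fib_pred_even k : ~~ odd k ->
  zeckendorf_sum (fib k.+2).-1 = zeckendorf_sum (fib k.+1).-1.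
Proof.
move=> evk; rewrite -(even_halfK evk); elim: k./2 => [//|a IHa].
rewrite doubleS zeckendorf_sum_fib_pred IHa.
(* The recursion does not reach $F_3-1$, so $k=2$ is computed: both sums are 1. *)
case: a {IHa} => [|a]; last by rewrite doubleS zeckendorf_sum_fib_pred.
by rewrite (zeckendorf_sum_fib 0%N) /zeckendorf_sum big_ord0.
Qed.

Lemma feedback_zeckendorf_gt k N M : (1 < k)%N -> (fib k + fib k.+2 < N)%N ->
  feedback zeckendorf_seq N M -> (fib k + ~~ odd k < M)%N.
Proof.
case: k => [//|[//|k]] _ ltN.
move: (fib_gt0 k) (fib_gt0 k.+1) (fib_gt0 k.+2) (fib_gt0 k.+3) => p1 p2 p3 p4.
move: (fibSS k) (fibSS k.+1) (fibSS k.+2) => F2 F3 F4.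
have agree n : (n < fib k.+2)%N ->
    zeckendorf_sum (fib k.+3 + n) = zeckendorf_sum (fib k.+4 + n).
  by move=> ltn; rewrite !zeckendorf_sum_fibD //; lia.
have differ : zeckendorf_seq (fib k.+3 + fib k.+2)%N
    != zeckendorf_seq (fib k.+4 + fib k.+2)%N.
  (* The left position is $F_{k+4}$, with digit sum 1; the right one has digit sum 2. *)
  rewrite -fibSS /zeckendorf_seq zeckendorf_sum_fib zeckendorf_sum_fibD; last lia.
  by rewrite zeckendorf_sum_fib.
case: (boolP (odd k.+2)) => [oddk|evk] /=.
  rewrite addn0; apply: (@feedback_order_gt _ _ _ _ (fib k.+3) (fib k.+4)) => //;
    try lia.
  by move=> n ltn; rewrite /zeckendorf_seq agree.
apply: (@feedback_order_gt _ _ _ _ (fib k.+3).-1 (fib k.+4).-1); try lia.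
  move=> [|n] ltn; rewrite /zeckendorf_seq.
    by rewrite !addn0 (zeckendorf_sum_fib_pred_even k.+2).
  have predS m : (0 < m)%N -> (m.-1 + n.+1 = m + n)%N by lia.
  by rewrite !predS // agree //; lia.
have predS m : (0 < m)%N -> (m.-1 + (fib k.+2 + 1) = m + fib k.+2)%N by lia.
by rewrite !predS.
Qed.

(** The upper end for $k$ is the lower end for $k+1$, so these intervals tile everything above
    $F_2+F_4=4$. *)
Lemma fib_bracket N : (4 < N)%N ->
  exists2 k, (1 < k)%N & (fib k + fib k.+2 < N <= fib k.+1 + fib k.+3)%N.
Proof.
elim: N => [//|N IHN]; rewrite ltnS leq_eqVlt => /predU1P[<-|/IHN[k k1]].
  by exists 2%N.
case/andP=> ltN; rewrite leq_eqVlt => /predU1P[eqN|ltN'].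
  exists k.+1; first exact: ltnW.
  rewrite eqN leqnn /= [fib k.+2]fibSS [fib k.+4]fibSS.
  by case: k k1 {ltN eqN} => [//|k] _; have := fib_gt0 k; have := fib_gt0 k.+2; lia.
by exists k => //; rewrite ltN' (ltn_trans ltN).
Qed.

(** Each step multiplies the error by the conjugate root $1-\varphi$, because
    $-\varphi(1-\varphi)=1$. *)
Lemma fib_golden_error (R : comNzRingType) (phi : R) k : phi ^+ 2 = phi + 1 ->
  (fib k.+1)%:R - phi * (fib k)%:R = (1 - phi) ^+ k.
Proof.
move=> phi2; elim: k => [|k IHk]; first by rewrite mulr0 subr0.
rewrite exprS -IHk fibSS natrD.
by ring: phi2.
Qed.

Theorem theorem1p1 (R : realType) :
  let phi : R := (1 + Num.sqrt 5) / 2 in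
  exists N0 : nat, (0 < N0)%N /\
    forall N : nat, (N0 < N)%N ->
      1 / (phi + phi ^+ 3) * N%:R + 1
        <= (max_order_complexity zeckendorf_seq N)%:R.
Proof.
move=> phi; exists 4%N; split=> // N ltN.
have sqrt5 : Num.sqrt 5 ^+ 2 = 5 :> R by rewrite sqr_sqrtr.
have sqrt5_ge0 : 0 <= Num.sqrt 5 :> R by exact: sqrtr_ge0.
have phi2 : phi ^+ 2 = phi + 1 by rewrite /phi; field: sqrt5.
have [phi_ge1 phi_le2] : 1 <= phi /\ phi <= 2 by rewrite /phi; split; nra.
have phi3 : phi + phi ^+ 3 = 3 * phi + 1 by rewrite exprS phi2; ring: phi2.
have [k k1 /andP[ltkN leNk]] := fib_bracket _ ltN.
rewrite /max_order_complexity; case: ifP => [/forallP const|_].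
  (* The constant case is void: $s_0=0$ and $s_1=1$. *)
  have lt1 : (1 < N.-1)%N by lia.
  have := const (Ordinal lt1).
  by rewrite /= /zeckendorf_seq (zeckendorf_sum_fib 0%N) /zeckendorf_sum big_ord0.
case: ex_minnP => M /andP[_ /asboolP fbM] _.
have ltM := feedback_zeckendorf_gt _ _ _ k1 ltkN fbM.
have leM : (fib k)%:R + (~~ odd k)%:R + 1 <= M%:R :> R.
  by rewrite -natrD natr1 ler_nat.
apply: le_trans leM; rewrite lerD2r mul1r phi3 mulrC ler_pdivrMr; last by lra.
(* It remains to show $N \le (3\varphi+1)(F_k+[k \text{ even}])$. The golden error turns this bound
   into $(3\varphi+1)F_k + 3(1-\varphi)^k$. *)
have leN : N%:R <= 3 * (fib k.+1)%:R + (fib k)%:R :> R.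
  rewrite -natrM -natrD ler_nat; apply: leq_trans leNk _.
  by rewrite [fib k.+3]fibSS [fib k.+2]fibSS; lia.
have := fib_golden_error R phi k phi2.
case: (boolP (odd k)) => [oddk|evk] /= err.
  have : (1 - phi) ^+ k <= 0 by rewrite exprn_odd_le0 // subr_le0.
  by nra.
(* For even $k$ the excess is at most $3 \le 3\varphi+1$, the gain from the longer window. *)
have : (1 - phi) ^+ k <= 1.
  rewrite -(even_halfK evk) -mul2n exprM; apply: exprn_ile1; nra.
by nra.
Qed.
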